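(* Let $r \geq 3$ be a fixed integer, let $p = p(n) \in [0,1]$, and let $d = d(n) = (n-(r-1))p$. If $d \leq 1/(r-1)$, then with high probability $$\nu^{(r-1)}(H_r(n,p)) \sim \tau^{(r-1)}(H_r(n,p)).$$
   Context: An $r$-graph $G$ is a set of $r$-element subsets (edges) of a vertex set $V(G)$. An $(r-1)$-matching in $G$ is a set of edges of $G$ any two distinct members of which intersect in fewer than $r-1$ vertices; $\nu^{(r-1)}(G)$ is the maximum size of an $(r-1)$-matching in $G$. An $(r-1)$-cover of $G$ is a collection of $(r-1)$-element subsets of $V(G)$ such that every edge of $G$ contains at least one member of the collection; $\tau^{(r-1)}(G)$ is the minimum size of an $(r-1)$-cover of $G$. $H_r(n,p)$ denotes the random $r$-graph on a set $V$ of $n$ labelled vertices in which each $r$-element subset of $V$ is an edge with probability $p$, independently of the others; $d$ is the expected number of edges containing a given $(r-1)$-set. ''With high probability'' means with probability tending to $1$ as $n \to \infty$. $A \sim B$ means $A/B \to 1$ as $n\to\infty$; for random variables, ''$A_n \sim B_n$ with high probability'' means that there is a deterministic sequence $\varepsilon_n \to 0$ such that $|A_n - B_n| \leq \varepsilon_n B_n$ holds with probability tending to $1$ (so the case $A_n = B_n = 0$ is allowed). *)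

(* Defs.v *)
From mathcomp Require Import all_boot all_order all_algebra.
From mathcomp Require Import all_classical all_reals all_analysis.

Set Implicit Arguments.
Unset Strict Implicit.
Unset Printing Implicit Defensive.

Import Order.TTheory GRing.Theory Num.Theory.
Import numFieldNormedType.Exports.

Local Open Scope ring_scope.
Local Open Scope classical_set_scope.

Definition ksets (V : finType) (k : nat) : {set {set V}} :=
  [set S : {set V} | #|S| == k]%SET.

(* An r-graph is identified with its edge set; its vertex set is all of V. *)
Definition is_rgraph (V : finType) (r : nat) (G : {set {set V}}) : bool :=
  G \subset ksets V r.

Definition is_matching (V : finType) (r : nat) (G M : {set {set V}}) : bool :=
  (M \subset G) &&
  [forall e in M, forall f in M, (e != f) ==> (#|e :&: f|%SET < r.-1)%N].

Definition matching_number (V : finType) (r : nat) (G : {set {set V}}) : nat :=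
  \max_(M : {set {set V}} | is_matching r G M) #|M|.

Definition is_cover (V : finType) (r : nat) (G C : {set {set V}}) : bool :=
  (C \subset ksets V r.-1) && [forall e in G, exists S in C, S \subset e].

(* The family of all (r-1)-sets, used as the default point of the minimum, is
   a cover whenever G is an r-graph. *)
Definition cover_number (V : finType) (r : nat) (G : {set {set V}}) : nat :=
  #|[arg min_(C < ksets V r.-1 | is_cover r G C) #|C| ]|.

(* Probability that H_r(n,p) is equal to the r-graph G. *)
Definition Hr_weight (R : realType) (r n : nat) (p : R)
    (G : {set {set 'I_n}}) : R :=
  \prod_(e in ksets 'I_n r) (if e \in G then p else 1 - p).

Definition Hr_prob (R : realType) (r n : nat) (p : R)
    (E : pred {set {set 'I_n}}) : R :=
  \sum_(G : {set {set 'I_n}} | is_rgraph r G && E G) Hr_weight r p G.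

Definition whp (R : realType) (r : nat) (p : nat -> R)
    (E : forall n, pred {set {set 'I_n}}) : Prop :=
  (fun n => Hr_prob r (p n) (E n)) @ \oo --> (1 : R).

Definition whp_sim (R : realType) (r : nat) (p : nat -> R)
    (A B : forall n, {set {set 'I_n}} -> nat) : Prop :=
  exists2 eps : nat -> R, eps @ \oo --> (0 : R) &
    whp r p (fun n G => `|(A n G)%:R - (B n G)%:R| <= eps n * (B n G)%:R).

(* Main.v *)
Require Import Defs.
From mathcomp Require Import all_boot all_order all_algebra.
From mathcomp Require Import all_classical all_reals all_analysis.
From mathcomp Require Import fintype finset zify ring lra.

(** Two edges of an r-graph conflict when they share an (r-1)-set.  Exploring
    conflicts from an edge is close to a branching process: an edge has r-1
    shadow sets other than the one through which it was reached, each lying in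
    about d further edges, so the mean offspring is at most (r-1) d <= 1.  The
    process is at most critical, conflict components are nearly all tree-like,
    and on a tree-like r-graph nu = tau.  The proof makes this quantitative
    without any theory of branching processes.

    A subgraph has a leaf when some edge e meets its conflicting edges in one
    and the same (r-1)-set S.  If every nonempty subgraph has a leaf, then
    nu = tau by greed ([konig_of_leaves]): put e in the matching, S in the
    cover, discard the edges containing S.  In a leafless subgraph a
    non-backtracking walk e_0, e_1, ..., in which each edge replaces a vertex of
    its predecessor other than the one just added, can always be continued.  So
    for every k each of its edges starts a walk which either makes k fresh steps
    (each adding a vertex not seen before) or makes a stale step (adding an old
    vertex) within k steps ([no_leaf_walks]).  Deleting the starting edges of
    all such walks from any H included in G gives ([gap_le_walks])
       tau(G) - nu(G) <= #(G - H) + #(walks of these two kinds in H).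

    All edges of these walks are distinct, so a walk is present with
    probability q to its number of edges when the edges of H are independent
    with density q.  Put rho = (r-1)(n-r) q.  Fresh walks of length k have mean
    at most rho^k per starting state, whereas stale walks lose a factor n, since
    the vertex of the stale step is one of boundedly many.  At criticality rho^k
    does not decay, so H is chosen as a random thinning of G that keeps each
    edge with probability s < 1: this deletes a fraction 1-s of the edges and
    brings rho down to s.  With mu the mean number of edges, E(tau - nu) is at most
       mu ((1-s) + r s^L + O(1/n)),
    ([mean_gap]), which is o(mu) on taking s close to 1, then L large, then n
    large ([mean_gap_small]).

    It remains to compare mu with tau.  If mu is bounded, then tau = nu with high
    probability, the difference being an integer.  If mu is large, there are at
    least 3 mu / 4 edges by the second moment, and since the mean number of
    conflicts is at most a constant times mu, most edges conflict with few
    others, so that tau is at least a constant times mu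
    ([cover_ge_low_degree]).  A relative error 8/j is thus reached for every fixed j
    ([gap_prob]), and a diagonal choice of j as a function of n concludes. *)

Import Order.TTheory GRing.Theory Num.Theory.
Import numFieldNormedType.Exports.
Set Implicit Arguments.
Unset Strict Implicit.
Unset Printing Implicit Defensive.

(** * Leaves, walks and the gap between covers and matchings *)

Section Combinatorics.
Variables (V : finType) (r : nat).
Implicit Types (e f S U : {set V}) (G H C M D : {set {set V}}) (x y z : V).

Definition swap e y z : {set V} := z |: (e :\ y).

Lemma card_swap e y z : y \in e -> z \notin e -> #|swap e y z| = #|e|.
Proof.
move=> ye ze; rewrite /swap cardsU1 !inE negb_and ze orbT (cardsD1 y e) ye.
by [].
Qed.

Lemma adjacent_swap e f : #|e| = r -> #|f| = r -> e != f ->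
  (r.-1 <= #|e :&: f|)%N ->
  exists y z, [/\ y \in e, z \notin e & f = swap e y z].
Proof.
move=> er fr ef le.
have De : #|e :\: f| = (r - #|e :&: f|)%N by rewrite cardsD er.
have Df : #|f :\: e| = (r - #|e :&: f|)%N by rewrite cardsD fr setIC.
have ne : #|e :\: f| != 0%N.
  rewrite cards_eq0 setD_eq0; apply: contraNN ef => sef.
  by rewrite eqEcard sef er fr /=.
have e1 : #|e :\: f| == 1%N by lia.
have f1 : #|f :\: e| == 1%N by lia.
case/cards1P: e1 => y /setP ey; case/cards1P: f1 => z /setP fz.
exists y, z; have := ey y; have := fz z; rewrite !inE !eqxx.
move=> /andP[ze zf] /andP[yf ye]; split=> //.
apply/setP=> i; have := ey i; have := fz i; rewrite !inE.
by case: (i \in e); case: (i \in f) => //= <- <-.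
Qed.

(** All edges of H conflicting with e contain e minus x; stated through swaps,
    since the swaps of e are exactly the other r-sets sharing r-1 vertices
    with it. *)
Definition leaf H e x :=
  [/\ e \in H, x \in e & forall y z, y \in e :\ x -> z \notin e ->
      swap e y z \notin H].

Lemma rgraph_card H e : is_rgraph r H -> e \in H -> #|e| = r.
Proof. by move=> /subsetP HV /HV; rewrite inE => /eqP. Qed.

(** Koenig's equality for tree-like r-graphs, by greed on a leaf (e, x): an edge
    meeting e in an (r-1)-set meets it in e minus x, so once the edges containing
    that set are discarded, e conflicts with nothing that is left. *)
Lemma konig_of_leaves H : is_rgraph r H ->
  (forall H0, H0 \subset H -> H0 != set0 -> exists e x, leaf H0 e x) ->
  exists C M, [/\ is_cover r H C, is_matching r H M & (#|C| <= #|M|)%N].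
Proof.
have [m] := ubnP #|H|; elim: m H => // m IH H Hm rH lfH.
have [->|H0] := eqVneq H set0.
  exists set0, set0; split; rewrite ?cards0 // /is_cover /is_matching sub0set /=.
    by apply/forall_inP=> e; rewrite inE.
  by apply/forall_inP=> e; rewrite inE.
have [e [x [eH xe lf]]] := lfH H (subxx _) H0.
have er := rgraph_card rH eH.
pose S := e :\ x; pose H' := [set f in H | ~~ (S \subset f)]%SET.
have sH' : H' \subset H by apply/subsetP=> f; rewrite inE => /andP[].
have [||| C [M [Ccov Mmat CM]]] := IH H'.
- have: (#|H'| < #|H|)%N.
    apply: proper_card; rewrite properE sH' /=; apply/subsetPn; exists e => //.
    by rewrite inE eH /= negbK subD1set.
  by move=> h; apply: leq_trans h _; rewrite -ltnS.
- exact: subset_trans sH' rH.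
- by move=> H1 s1; apply: lfH; apply: subset_trans s1 sH'.
have /andP[sMH' Mm] := Mmat; have /andP[sC Cc] := Ccov.
have eM : e \notin M.
  by apply/negP=> /(subsetP sMH'); rewrite inE subD1set andbF.
have apart f : f \in M -> (#|e :&: f| < r.-1)%N.
  move=> fM; have := subsetP sMH' _ fM; rewrite inE => /andP[fH Sf].
  rewrite ltnNge; apply/negP=> le.
  have ef : e != f by apply: contraNneq eM => ->.
  have [y [z [ye ze fE]]] := adjacent_swap er (rgraph_card rH fH) ef le.
  have yx : y != x.
    apply: contraNneq Sf => yx; rewrite fE yx; exact: subsetUr.
  by have := lf y z; rewrite !inE yx ye -fE fH; move=> /(_ isT ze).
exists (S |: C), (e |: M); split.
- apply/andP; split.
    rewrite subUset sC andbT sub1set inE; apply/eqP.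
    by move: er; rewrite (cardsD1 x e) xe => <-.
  apply/forall_inP=> f fH; apply/exists_inP.
  have [Sf|Sf] := boolP (S \subset f).
    by exists S => //; rewrite !inE eqxx.
  have fH' : f \in H' by rewrite inE fH.
  by have /exists_inP[T TC Tf] := forall_inP Cc f fH'; exists T; rewrite ?inE ?TC ?orbT.
- apply/andP; split; first by rewrite subUset sub1set eH (subset_trans sMH').
  apply/forall_inP=> f /setU1P[->|fM]; apply/forall_inP=> g /setU1P[->|gM].
  + by rewrite eqxx.
  + by apply/implyP=> _; apply: apart.
  + by apply/implyP=> _; rewrite setIC; apply: apart.
  + exact: (forall_inP (forall_inP Mm f fM) g gM).
- by rewrite !cardsU1 eM; apply: leq_add => //; apply: leq_b1.
Qed.

(** The number of non-backtracking k-step walks in H continuing from the edge e,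
    when x is the vertex added last and U contains all vertices seen so far.
    Not removing x is what forbids backtracking: removing it would lead through
    the (r-1)-set by which e was entered. *)
Fixpoint fresh_walks k U e x H : nat :=
  if k is k'.+1 then
    \sum_(y in e :\ x) \sum_(z in ~: U)
      (swap e y z \in H) * fresh_walks k' (z |: U) (swap e y z) z H
  else 1.

(** Walks of at most k steps which end at their first stale step, the one
    adding an already seen vertex. *)
Fixpoint stale_walks k U e x H : nat :=
  if k is k'.+1 then
    \sum_(y in e :\ x)
      (\sum_(z in U :\: e) (swap e y z \in H) +
       \sum_(z in ~: U)
         (swap e y z \in H) * stale_walks k' (z |: U) (swap e y z) z H)
  else 0.

Lemma leq_term (I : finType) (A : {set I}) (F : I -> nat) i :
  i \in A -> (F i <= \sum_(j in A) F j)%N.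
Proof. by move=> iA; rewrite (bigD1 i) //= leq_addr. Qed.

Lemma swap_sub e y z U : e \subset U -> swap e y z \subset z |: U.
Proof. by move=> eU; apply: setUS; apply: subset_trans (subD1set _ _) eU. Qed.

(** Without leaves there is always a conflict avoiding the (r-1)-set e minus x,
    so a walk of fresh steps continues for k steps unless a stale step occurs. *)
Lemma no_leaf_walks H0 k U e x : (forall e x, ~ leaf H0 e x) ->
  e \in H0 -> x \in e -> e \subset U ->
  (0 < fresh_walks k U e x H0 + stale_walks k U e x H0)%N.
Proof.
move=> nl; elim: k U e x => // k IH U e x eH xe eU.
have [y [z [yx ze fH]]] : exists y z, [/\ y \in e :\ x, z \notin e & swap e y z \in H0].
  apply: contrapT => h; apply: (nl e x); split=> // y z yx ze.
  by apply/negP=> fH; apply: h; exists y, z.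
have zf : z \in swap e y z by rewrite !inE eqxx.
rewrite addn_gt0 /=; have [zU|zU] := boolP (z \in U).
  apply/orP; right; apply: leq_trans (leq_term _ yx).
  rewrite addn_gt0; apply/orP; left.
  have zUe : z \in U :\: e by rewrite !inE ze.
  by apply: leq_trans (leq_term _ zUe); rewrite fH.
have zC : z \in ~: U by rewrite inE.
have := IH (z |: U) (swap e y z) z fH zf (swap_sub _ _ eU).
rewrite addn_gt0 => /orP[] h; apply/orP; [left|right].
  apply: leq_trans (leq_term _ yx); apply: leq_trans (leq_term _ zC).
  by rewrite fH mul1n.
apply: leq_trans (leq_term _ yx); rewrite addn_gt0; apply/orP; right.
by apply: leq_trans (leq_term _ zC); rewrite fH mul1n.
Qed.

Lemma indicator_mono H H' f : H \subset H' -> ((f \in H) <= (f \in H'))%N.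
Proof. by move=> s; case: (boolP (f \in H)) => // /(subsetP s) ->. Qed.

Lemma fresh_walks_mono k U e x H H' : H \subset H' ->
  (fresh_walks k U e x H <= fresh_walks k U e x H')%N.
Proof.
move=> s; elim: k U e x => //= k IH U e x.
apply: leq_sum => y _; apply: leq_sum => z _; apply: leq_mul => //.
exact: indicator_mono.
Qed.

Lemma stale_walks_mono k U e x H H' : H \subset H' ->
  (stale_walks k U e x H <= stale_walks k U e x H')%N.
Proof.
move=> s; elim: k U e x => //= k IH U e x.
apply: leq_sum => y _; apply: leq_add.
  by apply: leq_sum => z _; exact: indicator_mono.
apply: leq_sum => z _; apply: leq_mul => //.
exact: indicator_mono.
Qed.

Lemma ksets_cover G : is_rgraph r G -> is_cover r G (ksets V r.-1).
Proof.
move=> rG; apply/andP; split=> //; apply/forall_inP=> e eG; apply/exists_inP.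
have er := rgraph_card rG eG.
have [S [sS cS]] : exists S, S \subset e /\ #|S| = r.-1.
  case: (set_0Vmem e) er => [->|[x xe]] er.
    by exists set0; rewrite sub0set -er cards0.
  by exists (e :\ x); rewrite subD1set; split=> //; move: er; rewrite (cardsD1 x) xe => <-.
by exists S => //; rewrite inE cS.
Qed.

Lemma cover_number_le G C : is_rgraph r G -> is_cover r G C ->
  (cover_number r G <= #|C|)%N.
Proof.
move=> rG cC; rewrite /cover_number; case: arg_minnP; last by move=> D _; apply.
exact: ksets_cover.
Qed.

Lemma cover_number_attained G : is_rgraph r G ->
  exists2 C, is_cover r G C & cover_number r G = #|C|.
Proof.
move=> rG; rewrite /cover_number; case: arg_minnP; first exact: ksets_cover.
by move=> C cC _; exists C.
Qed.

Lemma le_matching_number G M : is_matching r G M -> (#|M| <= matching_number r G)%N.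
Proof. by move=> mM; apply: leq_bigmax_cond. Qed.

Lemma matching_le_cover G : is_rgraph r G ->
  (matching_number r G <= cover_number r G)%N.
Proof.
move=> rG; have [C /andP[sC cC] ->] := cover_number_attained rG.
apply/bigmax_leqP=> M /andP[sM mM].
pose c e := odflt set0 [pick S in C | S \subset e].
have cP e : e \in M -> c e \in C /\ c e \subset e.
  move=> eM; rewrite /c; case: pickP => [S /andP[]//|].
  have /exists_inP[S SC Se] := forall_inP cC e (subsetP sM _ eM).
  by move/(_ S); rewrite SC Se.
have inj : {in M &, injective c}.
  move=> e f eM fM ef; apply/eqP; apply: contraT => nef.
  have := implyP (forall_inP (forall_inP mM e eM) f fM) nef.
  have [ceC ce] := cP e eM; have [_ cf] := cP f fM.
  have := subsetP sC _ ceC; rewrite inE => /eqP <-.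
  by rewrite ltnNge => /negP[]; apply: subset_leq_card; rewrite subsetI ce ef.
rewrite -(card_in_imset inj); apply: subset_leq_card.
by apply/subsetP=> S /imsetP[e eM ->]; case: (cP e eM).
Qed.

(** Each deleted edge is covered again by one of its own (r-1)-subsets. *)
Lemma cover_delete G H : H \subset G -> is_rgraph r G ->
  (cover_number r G <= cover_number r H + #|G :\: H|)%N.
Proof.
move=> sHG rG; have rH : is_rgraph r H := subset_trans sHG rG.
have [C /andP[sC cC] ->] := cover_number_attained rH.
have /andP[_ kC] := ksets_cover rG.
pose c e := odflt set0 [pick S in ksets V r.-1 | S \subset e].
have cP e : e \in G -> c e \in ksets V r.-1 /\ c e \subset e.
  move=> eG; rewrite /c; case: pickP => [S /andP[]//|].
  have /exists_inP[S SC Se] := forall_inP kC e eG.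
  by move/(_ S); rewrite SC Se.
have cov : is_cover r G (C :|: c @: (G :\: H)).
  apply/andP; split.
    rewrite subUset sC /=; apply/subsetP=> S /imsetP[e /setDP[eG _] ->].
    by case: (cP e eG).
  apply/forall_inP=> e eG; apply/exists_inP; have [eH|eH] := boolP (e \in H).
    have /exists_inP[S SC Se] := forall_inP cC e eH.
    by exists S => //; rewrite inE SC.
  have [_ ce] := cP e eG; exists (c e) => //.
  by rewrite inE imset_f ?orbT // inE eH.
apply: leq_trans (cover_number_le rG cov) _.
apply: leq_trans (leq_card_setU _ _) _; rewrite leq_add2l.
exact: leq_imset_card.
Qed.

Definition walk_total k H : nat :=
  \sum_(e in H) \sum_(x in e) (fresh_walks k e e x H + stale_walks k e e x H).

(** Deleting from H every edge that starts a walk leaves a graph all of whose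
    nonempty subgraphs have leaves: walks in a leafless subgraph would be walks
    in H. *)
Lemma gap_le_walks k G H : (0 < r)%N -> H \subset G -> is_rgraph r G ->
  (cover_number r G - matching_number r G <= #|G :\: H| + walk_total k H)%N.
Proof.
move=> r0 sHG rG; have rH : is_rgraph r H := subset_trans sHG rG.
pose w e := (\sum_(x in e) (fresh_walks k e e x H + stale_walks k e e x H))%N.
pose K := [set e in H | w e == 0]%SET.
have sKH : K \subset H by apply/subsetP=> e; rewrite inE => /andP[].
have rK : is_rgraph r K := subset_trans sKH rH.
have [|C [M [cC mM CM]]] := konig_of_leaves rK.
  move=> H0 sH0 nH0; apply: contrapT => nl.
  have [e eH0] : exists e, e \in H0 by apply/set0Pn.
  have eK := subsetP sH0 _ eH0; have er := rgraph_card rK eK.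
  have [x xe] : exists x, x \in e by apply/set0Pn; rewrite -cards_eq0 er -lt0n.
  have nl' e' x' : ~ leaf H0 e' x' by move=> l; apply: nl; exists e', x'.
  have := no_leaf_walks k nl' eH0 xe (subxx e).
  move: eK; rewrite inE => /andP[_]; rewrite sum_nat_eq0 => /forall_inP/(_ x xe).
  rewrite addn_eq0 => /andP[/eqP a0 /eqP b0].
  have sH0H := subset_trans sH0 sKH.
  have := fresh_walks_mono k e e x sH0H; have := stale_walks_mono k e e x sH0H.
  by rewrite a0 b0; lia.
have h1 := cover_delete sKH rH; have h2 := cover_delete sHG rG.
have h3 := cover_number_le rK cC.
have h4 : (#|M| <= matching_number r G)%N.
  apply: le_matching_number; move: mM => /andP[sM mM]; apply/andP; split=> //.
  exact: subset_trans sM (subset_trans sKH sHG).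
have h5 : (#|H :\: K| <= walk_total k H)%N.
  rewrite -sum1_card /walk_total [leqRHS](big_setID (H :\: K)) /=.
  apply: leq_trans (leq_addr _ _).
  rewrite (setIidPr (subsetDl _ _)); apply: leq_sum => e.
  by rewrite !inE => /andP[+ eH]; rewrite eH /= lt0n.
lia.
Qed.

(** An (r-1)-set inside an edge with fewer than t conflicts lies in at most t
    edges, so a cover has at least 1/t times as many members as there are such
    edges; the other edges contribute at least t conflicts each.  One-step walks
    count every conflict r-1 >= 1 times. *)
Lemma cover_ge_low_degree t G C : (1 < r)%N -> is_rgraph r G -> is_cover r G C ->
  (t * #|G| <= t * t * #|C| +
     \sum_(e in G) \sum_(x in e) fresh_walks 1 e e x G)%N.
Proof.
move=> r1 rG /andP[sC cC].
have rS : (r - r.-1)%N = 1%N by lia.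
have rP : r.-1.+1 = r by lia.
have r1' : r.-1 != 0%N by lia.
pose dg e := (\sum_(x in e) fresh_walks 1 e e x G)%N.
pose Lo := [set e in G | (dg e < t)%N]%SET.
have sLo : Lo \subset G by apply/subsetP=> e; rewrite inE => /andP[].
have star S e : S \in C -> e \in G -> S \subset e ->
    (#|[set f in G | S \subset f]%SET| <= (dg e).+1)%N.
  move=> SC eG Se; have er := rgraph_card rG eG.
  have Sr : #|S| = r.-1 by have := subsetP sC _ SC; rewrite inE => /eqP.
  have [x xS] : exists x, x \in S by apply/set0Pn; rewrite -cards_eq0 Sr.
  have /cards1P[y ey] : #|e :\: S| == 1%N by rewrite cardsD (setIidPr Se) er Sr rS.
  have /setDP[ye yS] : y \in e :\: S by rewrite ey inE.
  have SE : S = e :\ y.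
    apply/eqP; rewrite eqEcard subsetD1 Se yS /=.
    by move: er; rewrite (cardsD1 y e) ye Sr => <-.
  pose Z := [set z in ~: e | swap e y z \in G]%SET.
  have sub : [set f in G | S \subset f]%SET \subset e |: swap e y @: Z.
    apply/subsetP=> f; rewrite inE => /andP[fG Sf]; rewrite in_setU1.
    have fr := rgraph_card rG fG.
    have [//|fe] := eqVneq f e; apply/orP; right.
    have /cards1P[z fz] : #|f :\: S| == 1%N by rewrite cardsD (setIidPr Sf) fr Sr rS.
    have /setDP[zf zS] : z \in f :\: S by rewrite fz inE.
    have fE : f = swap e y z.
      apply/eqP; rewrite eq_sym eqEcard /swap -SE subUset sub1set zf Sf /=.
      by rewrite cardsU1 zS Sr fr add1n rP.
    have ze : z \notin e.
      apply: contra fe => ze; rewrite fE; have := zS; rewrite SE !inE ze andbT negbK.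
      by move=> /eqP ->; rewrite /swap setD1K.
    by apply/imsetP; exists z => //; rewrite !inE ze -fE.
  apply: leq_trans (subset_leq_card sub) _.
  apply: leq_trans (leq_card_setU _ _) _; rewrite cards1 add1n ltnS.
  apply: leq_trans (leq_imset_card _ _) _.
  have xe := subsetP Se _ xS.
  have yex : y \in e :\ x.
    by rewrite !inE ye andbT; apply: contraNneq yS => ->.
  apply: leq_trans (leq_term _ xe) => /=; apply: leq_trans (leq_term _ yex).
  rewrite -sum1_card big_mkcond [leqRHS]big_mkcond /=.
  apply: leq_sum => z _; rewrite !inE muln1.
  by case: (z \in e) => //=; case: (_ \in G).
have Lo_le : (#|Lo| <= t * #|C|)%N.
  have sub : Lo \subset \bigcup_(S in C) [set f in Lo | S \subset f]%SET.
    apply/subsetP=> e eL; have /exists_inP[S SC Se] := forall_inP cC e (subsetP sLo _ eL).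
    by apply/bigcupP; exists S => //; rewrite inE eL.
  apply: leq_trans (subset_leq_card sub) _.
  apply: leq_trans (_ : _ <= \sum_(S in C) #|[set f in Lo | S \subset f]%SET|)%N _.
    elim/big_rec2: _ => [|S m A _ h]; first by rewrite cards0.
    by apply: leq_trans (leq_card_setU _ _) _; rewrite leq_add2l.
  rewrite mulnC -sum_nat_const; apply: leq_sum => S SC.
  have [->|[e]] := set_0Vmem [set f in Lo | S \subset f]%SET; first by rewrite cards0.
  rewrite !inE => /andP[/andP[eG dl] Se]; apply: leq_trans dl.
  apply: leq_trans (star S e SC eG Se); apply: subset_leq_card.
  by apply/subsetP=> f; rewrite !inE => /andP[/andP[-> _] ->].
have Hi : (t * #|G :\: Lo| <= \sum_(e in G) dg e)%N.
  rewrite [leqRHS](big_setID (G :\: Lo)) /=; apply: leq_trans (leq_addr _ _).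
  rewrite (setIidPr (subsetDl _ _)) mulnC -sum_nat_const.
  by apply: leq_sum => e; rewrite !inE => /andP[+ eG]; rewrite eG /= -leqNgt.
have := cardsID Lo G; rewrite (setIidPr sLo) => <-; rewrite mulnDr.
apply: leq_add => //; rewrite -mulnA leq_mul2l Lo_le orbT; exact.
Qed.
End Combinatorics.

Local Open Scope ring_scope.

(** * Means and probabilities on a finite weighted space *)

Lemma eq_ler (R : realType) (x y : R) : x = y -> x <= y.
Proof. by move=> ->. Qed.

Section Mean.
Variables (R : realType) (T : finType) (w : T -> R).
Hypothesis w_ge0 : forall t, 0 <= w t.

Definition mean (f : T -> nat) : R := \sum_t w t * (f t)%:R.

Lemma mean_le f g : (forall t, w t != 0 -> (f t <= g t)%N) -> mean f <= mean g.
Proof.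
move=> fg; apply: ler_sum => t _; have [->|w0] := eqVneq (w t) 0; first by rewrite !mul0r.
by apply: ler_wpM2l => //; rewrite ler_nat fg.
Qed.

Lemma eq_mean f g : (forall t, w t != 0 -> f t = g t) -> mean f = mean g.
Proof.
move=> fg; apply: eq_bigr => t _; have [->|w0] := eqVneq (w t) 0; first by rewrite !mul0r.
by rewrite fg.
Qed.

Lemma meanD f g : mean (fun t => f t + g t)%N = mean f + mean g.
Proof. by rewrite -big_split; apply: eq_bigr => t _; rewrite natrD mulrDr. Qed.

Lemma mean_sum (I : finType) (A : {set I}) (F : I -> T -> nat) :
  mean (fun t => \sum_(i in A) F i t)%N = \sum_(i in A) mean (F i).
Proof.
by rewrite exchange_big; apply: eq_bigr => t _; rewrite natr_sum mulr_sumr.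
Qed.

Definition prob (P : pred T) : R := \sum_(t | P t) w t.

Lemma mean_markov (P : pred T) (f : T -> nat) (a : R) : 0 < a ->
  (forall t, P t -> a <= (f t)%:R) -> prob P <= mean f / a.
Proof.
move=> a0 Pf; rewrite ler_pdivlMr // /prob mulr_suml big_mkcond; apply: ler_sum => t _.
by case: ifP => [/Pf h|_]; rewrite ?ler_wpM2l ?mulr_ge0.
Qed.

Lemma prob_le (P Q : pred T) : (forall t, w t != 0 -> P t -> Q t) -> prob P <= prob Q.
Proof.
move=> PQ; rewrite /prob big_mkcond [leRHS]big_mkcond; apply: ler_sum => t _.
have [w0|w0] := eqVneq (w t) 0; first by rewrite w0; do 2 case: ifP.
have := PQ t w0; case: (P t) => [/(_ isT) ->|_] //; by case: (Q t).
Qed.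

Lemma probU (P Q : pred T) : prob (predU P Q) <= prob P + prob Q.
Proof.
rewrite /prob big_mkcond [X in _ <= X + _]big_mkcond [X in _ <= _ + X]big_mkcond.
rewrite -big_split; apply: ler_sum => t _ /=.
by have := w_ge0 t; case: (P t); case: (Q t) => /=; lra.
Qed.
End Mean.

(** * Expected numbers of walks *)

(** [H] is a random r-graph whose edges are independent with density q, in the
    weak sense [H_incl] of inclusion probabilities; this form covers both the
    random r-graph itself and its thinnings. *)
Section WalkMean.
Variables (R : realType) (V : finType) (r : nat) (T : finType) (w : T -> R).
Variables (H : T -> {set {set V}}) (q : R).
Hypotheses (w_ge0 : forall t, 0 <= w t) (q_ge0 : 0 <= q).
Hypothesis H_rgraph : forall t, w t != 0 -> is_rgraph r (H t).
Hypothesis H_incl : forall D : {set {set V}}, D \subset ksets V r ->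
  mean w (fun t => D \subset H t) = q ^+ #|D|.
Implicit Types (e f U : {set V}) (D : {set {set V}}) (x y z : V).

(** What is known when a walk arrives at e: D is the set of edges used so far,
    all inside U, and x is a vertex of e that no earlier edge contains. *)
Definition walk_state D U e x :=
  [/\ D \subset ksets V r, e \in D, x \in e,
      (forall f, f \in D -> f \subset U) & forall f, f \in D -> x \in f -> f = e].

Lemma walk_state_card D U e x : walk_state D U e x -> #|e| = r.
Proof. by move=> [/subsetP sD eD _ _ _]; have := sD _ eD; rewrite inE => /eqP. Qed.

Lemma fresh_step D U e x y z : walk_state D U e x -> y \in e :\ x -> z \in ~: U ->
  swap e y z \notin D /\ walk_state (swap e y z |: D) (z |: U) (swap e y z) z.
Proof.
move=> st; have er := walk_state_card st; case: st => sD eD xe DU xD.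
rewrite in_setD1 in_setC => /andP[yx ye] zU.
have ze : z \notin e by apply: contra zU; apply/subsetP/DU.
have zs : z \in swap e y z by rewrite !inE eqxx.
split; first by apply: contra zU => /DU/subsetP; apply.
split=> //.
- by rewrite subUset sub1set sD inE card_swap // er eqxx.
- by rewrite !inE eqxx.
- move=> f /setU1P[->|/DU fU]; first by apply/swap_sub/DU.
  exact: subset_trans fU (subsetUr _ _).
- by move=> f /setU1P[//|/DU/subsetP fU /fU]; rewrite (negPf zU).
Qed.

(** Even a stale step leads to an unused edge: the new edge keeps x, which among
    used edges only e contains, and it differs from e.  Hence it costs a full
    factor q. *)
Lemma stale_step D U e x y z : walk_state D U e x -> y \in e :\ x -> z \in U :\: e ->
  swap e y z \notin D /\ swap e y z |: D \subset ksets V r.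
Proof.
move=> st; have er := walk_state_card st; case: st => sD eD xe DU xD.
rewrite in_setD1 => /andP[yx ye] /setDP[zU ze].
split; last by rewrite subUset sub1set sD inE card_swap // er eqxx.
apply: contra ze => /xD sw; rewrite -sw; first by rewrite !inE eqxx.
by rewrite !inE xe [x == y]eq_sym yx orbT.
Qed.

Lemma incl_setU1 f D (G : {set {set V}}) m :
  ((D \subset G) * ((f \in G) * m) = (f |: D \subset G) * m)%N.
Proof. by rewrite subUset sub1set -mulnb mulnA (mulnC (f \in G)). Qed.

Lemma card_setC_le D U e x : walk_state D U e x -> (#|~: U| <= #|V| - r)%N.
Proof.
move=> st; have er := walk_state_card st; case: st => sD eD xe DU xD.
by rewrite cardsCs finset.setCK leq_sub2l // -er subset_leq_card // DU.
Qed.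

Lemma card_setD1_state D U e x : walk_state D U e x -> #|e :\ x| = r.-1.
Proof.
by move=> st; have := walk_state_card st; case: st => _ _ xe _ _; rewrite (cardsD1 x) xe => <-.
Qed.

Let rho : R := (r.-1)%:R * (#|V| - r)%:R * q.

Lemma rho_ge0 : 0 <= rho. Proof. by rewrite /rho !mulr_ge0. Qed.

(** Carrying the event that D is present along the recursion lets each step
    multiply the probability by q exactly, without exposing edges one at a time.
    There are r-1 vertices to remove and at most n-r to add. *)
Lemma mean_fresh_walks k D U e x : walk_state D U e x ->
  mean w (fun t => (D \subset H t) * fresh_walks k U e x (H t))%N <= q ^+ #|D| * rho ^+ k.
Proof.
elim: k D U e x => [|k IH] D U e x st.
  rewrite expr0 mulr1 -H_incl; last by case: st.
  by apply: mean_le => // t _; rewrite muln1.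
have -> : mean w (fun t => (D \subset H t) * fresh_walks k.+1 U e x (H t))%N =
  \sum_(y in e :\ x) \sum_(z in ~: U) mean w (fun t =>
    (swap e y z |: D \subset H t) * fresh_walks k (z |: U) (swap e y z) z (H t))%N.
  under eq_bigr do rewrite -mean_sum; rewrite -mean_sum.
  apply: eq_mean => t _ /=; rewrite big_distrr; apply: eq_bigr => y _.
  rewrite big_distrr; apply: eq_bigr => z _; exact: incl_setU1.
apply: (@le_trans _ _ (\sum_(y in e :\ x) \sum_(z in ~: U) (q ^+ #|D|.+1 * rho ^+ k))).
  apply: ler_sum => y yx; apply: ler_sum => z zU.
  have [nD st'] := fresh_step st yx zU.
  by have := IH _ _ _ _ st'; rewrite cardsU1 nD.
under eq_bigr do rewrite sumr_const; rewrite sumr_const -mulrnA.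
rewrite (card_setD1_state st) exprS [in leRHS]exprS {2}/rho.
rewrite -[_ *+ _]mulr_natl natrM.
have h : (#|~: U|%:R : R) <= (#|V| - r)%:R by rewrite ler_nat (card_setC_le st).
have ck : 0 <= rho ^+ k by rewrite exprn_ge0 ?rho_ge0.
have qD : 0 <= q ^+ #|D| by rewrite exprn_ge0.
have r0 : 0 <= (r.-1)%:R :> R by [].
move: h ck qD r0; move: (_%:R) (rho ^+ k) (q ^+ _) (_%:R) (_%:R : R) => a b d g h ab b0 d0 h0.
rewrite [leLHS](_ : _ = h * (a * q * d * b)); last by ring.
rewrite [leRHS](_ : _ = g * (a * q * d * b)); last by ring.
by apply: ler_wpM2r => //; rewrite !mulr_ge0.
Qed.

Hypothesis rho_le1 : rho <= 1.

(** The stale step has only |U| + k candidates for the added vertex, instead of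
    about n, and can be any of the k steps; the fresh steps before it
    contribute a factor at most 1 in total because rho <= 1. *)
Lemma mean_stale_walks k D U e x : walk_state D U e x ->
  mean w (fun t => (D \subset H t) * stale_walks k U e x (H t))%N <=
  q ^+ #|D| * (k%:R * ((r.-1)%:R * (#|U| + k)%:R * q)).
Proof.
elim: k D U e x => [|k IH] D U e x st.
  rewrite !mul0r mulr0 /mean big1 // => t _; by rewrite muln0 mulr0.
have -> : mean w (fun t => (D \subset H t) * stale_walks k.+1 U e x (H t))%N =
  \sum_(y in e :\ x) (\sum_(z in U :\: e) mean w (fun t => (swap e y z |: D \subset H t)) +
  \sum_(z in ~: U) mean w (fun t =>
    (swap e y z |: D \subset H t) * stale_walks k (z |: U) (swap e y z) z (H t))%N).
  under eq_bigr do rewrite -!mean_sum -meanD; rewrite -mean_sum.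
  apply: eq_mean => t _ /=; rewrite big_distrr; apply: eq_bigr => y _.
  rewrite /= mulnDr; congr addn; rewrite big_distrr; apply: eq_bigr => z _ /=.
    by have := incl_setU1 (swap e y z) D (H t) 1; rewrite !muln1.
  exact: incl_setU1.
pose b : R := k%:R * ((r.-1)%:R * (#|U| + k.+1)%:R * q).
have b0 : 0 <= b by rewrite /b !mulr_ge0.
have qD : 0 <= q ^+ #|D| by apply: exprn_ge0.
apply: (@le_trans _ _ (\sum_(y in e :\ x)
  (q ^+ #|D|.+1 * (#|U| + k.+1)%:R + q ^+ #|D|.+1 * b * (#|V| - r)%:R))).
  apply: ler_sum => y yx; apply: lerD.
    apply: (@le_trans _ _ (\sum_(z in U :\: e) q ^+ #|D|.+1)).
      apply: ler_sum => z zU; have [nD sD] := stale_step st yx zU.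
      by rewrite H_incl // cardsU1 nD.
    rewrite sumr_const -[leLHS]mulr_natr ler_wpM2l ?exprn_ge0 // ler_nat.
    by apply: leq_trans (subset_leq_card (subsetDl _ _)) (leq_addr _ _).
  apply: (@le_trans _ _ (\sum_(z in ~: U) (q ^+ #|D|.+1 * b))).
    apply: ler_sum => z zU; have [nD st'] := fresh_step st yx zU.
    have := IH _ _ _ _ st'; rewrite [#|swap _ _ _ |: _|]cardsU1 nD add1n => /le_trans; apply.
    rewrite ler_wpM2l ?exprn_ge0 // /b.
    by rewrite cardsU1; move: zU; rewrite in_setC => ->; rewrite add1n addSnnS.
  rewrite sumr_const -[leLHS]mulr_natr ler_wpM2l ?mulr_ge0 ?exprn_ge0 // ler_nat.
  exact: card_setC_le st.
rewrite sumr_const (card_setD1_state st) -[leLHS]mulr_natl exprS.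
rewrite [leLHS](_ : _ = q ^+ #|D| * ((r.-1)%:R * (#|U| + k.+1)%:R * q + rho * b)); last first.
  rewrite /rho; move: (_%:R) (q ^+ _) (_%:R) (_%:R : R) b {b0} => a d g h b; ring.
rewrite ler_wpM2l // -[X in _ <= X * _]natr1 mulrDl mul1r [leRHS]addrC lerD2l.
by rewrite -[leRHS]mul1r ler_wpM2r.
Qed.

Lemma walk_state_init e x : e \in ksets V r -> x \in e -> walk_state [set e] e e x.
Proof.
move=> ek xe; split=> //; first by rewrite sub1set.
- by rewrite inE.
- by move=> f; rewrite inE => /eqP ->.
- by move=> f; rewrite inE => /eqP ->.
Qed.

Lemma mean_edge_sum (F : {set V} -> V -> T -> nat) (B : R) :
  (forall e x, e \in ksets V r -> x \in e ->
     mean w (fun t => ([set e] \subset H t) * F e x t)%N <= B) ->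
  mean w (fun t => \sum_(e in H t) \sum_(x in e) F e x t)%N <= #|ksets V r|%:R * r%:R * B.
Proof.
move=> FB.
have -> : mean w (fun t => \sum_(e in H t) \sum_(x in e) F e x t)%N =
  \sum_(e in ksets V r) \sum_(x in e) mean w (fun t => ([set e] \subset H t) * F e x t)%N.
  under eq_bigr do rewrite -mean_sum; rewrite -mean_sum.
  apply: eq_mean => t /H_rgraph /subsetP rH.
  rewrite big_mkcond [in RHS]big_mkcond /=; apply: eq_bigr => e _.
  rewrite sub1set; have [/rH ->|_] := boolP (e \in H t).
    by under [in RHS]eq_bigr do rewrite mul1n.
  by case: ifP => // _; rewrite big1 // => x _; rewrite mul0n.
apply: (@le_trans _ _ (\sum_(e in ksets V r) \sum_(x in e) B)).
  by apply: ler_sum => e ek; apply: ler_sum => x xe; apply: FB.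
rewrite [leLHS](_ : _ = \sum_(e in ksets V r) (r%:R * B)).
  by rewrite sumr_const -[leLHS]mulr_natl mulrA.
by apply: eq_bigr => e; rewrite inE sumr_const => /eqP ->; rewrite mulr_natl.
Qed.

Lemma mean_fresh_total k :
  mean w (fun t => \sum_(e in H t) \sum_(x in e) fresh_walks k e e x (H t))%N <=
  #|ksets V r|%:R * r%:R * (q * rho ^+ k).
Proof.
apply: mean_edge_sum => e x ek xe.
by have := mean_fresh_walks k (walk_state_init ek xe); rewrite cards1.
Qed.

Lemma mean_walk_total k : mean w (fun t => walk_total k (H t)) <=
  #|ksets V r|%:R * r%:R * (q * (rho ^+ k + k%:R * ((r.-1)%:R * (r + k)%:R * q))).
Proof.
apply: mean_edge_sum => e x ek xe.
have st := walk_state_init ek xe.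
rewrite (eq_mean (g := fun t => (([set e] \subset H t) * fresh_walks k e e x (H t) +
  ([set e] \subset H t) * stale_walks k e e x (H t))%N)); last by move=> t _; rewrite mulnDr.
rewrite meanD mulrDr; apply: lerD.
  by have := mean_fresh_walks k st; rewrite cards1.
by have := mean_stale_walks k st; rewrite cards1 (walk_state_card st).
Qed.
End WalkMean.

(** * The random r-graph and its thinning *)
Section Law.
Variables (R : realType) (r n : nat).
Implicit Types (p s : R) (G D : {set {set 'I_n}}).

Definition law p G : R := if is_rgraph r G then Hr_weight r p G else 0.

Lemma law_rgraph p G : law p G != 0 -> is_rgraph r G.
Proof. by rewrite /law; case: ifP => //; rewrite eqxx. Qed.

Lemma law_ge0 p G : 0 <= p <= 1 -> 0 <= law p G.
Proof.
move=> /andP[p0 p1]; rewrite /law; case: ifP => // _.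
by apply: prodr_ge0 => e _; case: ifP => _ //; rewrite subr_ge0.
Qed.

(** The law as a product over all vertex sets, so that sums over all families
    factor; non-r-sets get weight 0 when present and 1 when absent. *)
Lemma lawE p G : law p G = \prod_(e : {set 'I_n})
  (if e \in G then (if e \in ksets 'I_n r then p else 0)
   else (if e \in ksets 'I_n r then 1 - p else 1)).
Proof.
rewrite /law; case: ifP => [/subsetP sG|/subsetPn[e eG ek]].
  rewrite /Hr_weight big_mkcond; apply: eq_bigr => e _.
  by case: ifP (sG e) => [_ _|_]; case: ifP => // _ /(_ isT).
by rewrite (bigD1 e) //= eG (negPf ek) mul0r.
Qed.

Lemma mean_law_incl p D : D \subset ksets 'I_n r ->
  mean (law p) (fun G => D \subset G) = p ^+ #|D|.
Proof.
move=> /subsetP sD; pose F (e : {set 'I_n}) : R := if e \in ksets 'I_n r then p else 0.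
(* Setting the weight of an absent member of D to 0 encodes the event that D is
   included in G. *)
pose K (e : {set 'I_n}) : R := if e \in D then 0 else if e \in ksets 'I_n r then 1 - p else 1.
transitivity (\sum_(G : {set {set 'I_n}}) \prod_e (if e \in G then F e else K e)).
  apply: eq_bigr => G _; rewrite lawE; have [/subsetP DG|/subsetPn[e eD eG]] := boolP (D \subset G).
    rewrite mulr1; apply: eq_bigr => e _; rewrite /F /K.
    case: ifP => // eG; have -> // : (e \in D) = false by apply/negP=> /DG; rewrite eG.
  by rewrite mulr0 (bigD1 e) //= (negPf eG) /K eD mul0r.
rewrite -bigA_distr (bigID (mem D)) /= [X in _ * X]big1 ?mulr1.
  rewrite -prodr_const; apply: eq_bigr => e eD.
  by rewrite /F /K eD (sD e eD) addr0.
by move=> e /negPf eD; rewrite /F /K eD; case: ifP => _; ring.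
Qed.

Lemma sum_law p : \sum_G law p G = 1.
Proof.
have := mean_law_incl p (sub0set _); rewrite cards0 expr0 => <-.
by apply: eq_bigr => G _; rewrite sub0set mulr1.
Qed.

(** The law of (G, G') with G and G' independent; the thinning of G is the
    intersection of G and G'. *)
Definition pair_law p s (t : {set {set 'I_n}} * {set {set 'I_n}}) : R :=
  law p t.1 * law s t.2.

Lemma mean_pair p s (f g : {set {set 'I_n}} -> nat) :
  mean (pair_law p s) (fun t => f t.1 * g t.2)%N = mean (law p) f * mean (law s) g.
Proof.
rewrite /mean big_distrlr /= pair_big /=; apply: eq_bigr => -[G G'] _ /=.
by rewrite /pair_law natrM /=; ring.
Qed.

Lemma mean_pair_incl p s D : D \subset ksets 'I_n r ->
  mean (pair_law p s) (fun t => D \subset t.1 :&: t.2) = (p * s) ^+ #|D|.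
Proof.
move=> sD; rewrite exprMn -!mean_law_incl // -mean_pair.
by apply: eq_mean => t _; rewrite subsetI mulnb.
Qed.

Lemma mean_pair_fst p s (f : {set {set 'I_n}} -> nat) :
  mean (pair_law p s) (fun t => f t.1) = mean (law p) f.
Proof.
rewrite -[RHS]mulr1 -(sum_law s).
rewrite (_ : \sum_G law s G = mean (law s) (fun=> 1%N)); last first.
  by apply: eq_bigr => G _; rewrite mulr1.
by rewrite -mean_pair; apply: eq_mean => t _; rewrite muln1.
Qed.

Lemma pair_law_ge0 p s t : 0 <= p <= 1 -> 0 <= s <= 1 -> 0 <= pair_law p s t.
Proof. by move=> hp hs; rewrite mulr_ge0 ?law_ge0. Qed.

Lemma mean_law_mem p e : e \in ksets 'I_n r -> mean (law p) (fun G => e \in G) = p.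
Proof.
move=> ek; rewrite -[RHS]expr1 -(cards1 e) -mean_law_incl ?sub1set //.
by apply: eq_mean => G _; rewrite sub1set.
Qed.

Lemma card_rgraph_sum G : is_rgraph r G -> #|G| = (\sum_(e in ksets 'I_n r) (e \in G))%N.
Proof.
move=> /subsetP sG; rewrite -sum1_card big_mkcond [RHS]big_mkcond; apply: eq_bigr => e _.
by case: ifP => [/sG ->//|_]; case: ifP.
Qed.

Lemma mean_thinned p s :
  mean (pair_law p s) (fun t => #|t.1 :\: (t.1 :&: t.2)|) = #|ksets 'I_n r|%:R * p * (1 - s).
Proof.
have -> : mean (pair_law p s) (fun t => #|t.1 :\: (t.1 :&: t.2)|) =
  mean (pair_law p s) (fun t => \sum_(e in ksets 'I_n r) (e \in t.1) * (e \notin t.2))%N.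
  apply: eq_mean => t; rewrite /pair_law mulf_eq0 negb_or => /andP[/law_rgraph /subsetP sG _].
  rewrite -sum1_card big_mkcond [RHS]big_mkcond; apply: eq_bigr => e _.
  rewrite !inE; have := sG e; rewrite inE; case: (e \in t.1); case: (e \in t.2) => //=.
  - by case: ifP.
  - by move=> ->.
  - by case: ifP.
  - by case: ifP.
rewrite mean_sum -mulrA [RHS]mulr_natl -sumr_const; apply: eq_bigr => e ek.
rewrite (mean_pair p s (fun G => e \in G) (fun G => e \notin G)) mean_law_mem //; congr (_ * _).
have : mean (law s) (fun G => (e \in G) + (e \notin G))%N = 1.
  by rewrite -(sum_law s); apply: eq_bigr => G _; case: (e \in G); rewrite mulr1.
by rewrite meanD mean_law_mem //; lra.
Qed.

Definition gap G : nat := (cover_number r G - matching_number r G)%N.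
Definition edges_mean p : R := #|ksets 'I_n r|%:R * p.

Lemma edges_mean_ge0 p : 0 <= p <= 1 -> 0 <= edges_mean p.
Proof. by case/andP=> p0 _; rewrite mulr_ge0. Qed.

(** The parameter s is the retention probability of the thinning: it costs the
    fraction 1-s of the edges and makes long fresh walks rare even when the
    exploration of the unthinned graph is critical. *)
Lemma mean_gap p s L : (0 < r)%N -> 0 <= p <= 1 -> 0 <= s <= 1 ->
  (r.-1)%:R * (n - r)%:R * p <= 1 ->
  mean (law p) gap <=
  edges_mean p * ((1 - s) + r%:R * (s ^+ L + L%:R * ((r.-1)%:R * (r + L)%:R * p))).
Proof.
move=> r0 hp hs c1.
have /andP[p0 p1] := hp; have /andP[s0 s1] := hs.
have w0 t : 0 <= pair_law p s t by apply: pair_law_ge0.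
have ps0 : 0 <= p * s by rewrite mulr_ge0.
have psp : p * s <= p by rewrite -[leRHS]mulr1 ler_wpM2l.
have cs : (r.-1)%:R * (#|'I_n| - r)%:R * (p * s) <= s.
  by rewrite card_ord mulrA -[leRHS]mul1r ler_wpM2r.
have Hr t : pair_law p s t != 0 -> is_rgraph r (t.1 :&: t.2).
  rewrite mulf_eq0 negb_or => /andP[/law_rgraph sG _].
  exact: subset_trans (subsetIl _ _) sG.
rewrite -(mean_pair_fst p s).
apply: (@le_trans _ _ (mean (pair_law p s) (fun t =>
  #|t.1 :\: (t.1 :&: t.2)| + walk_total L (t.1 :&: t.2))%N)).
  apply: mean_le => // t; rewrite mulf_eq0 negb_or => /andP[/law_rgraph sG _].
  by apply: gap_le_walks => //; apply: subsetIl.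
rewrite meanD mean_thinned [leRHS]mulrDr lerD2l.
have := mean_walk_total w0 ps0 Hr (@mean_pair_incl p s) (le_trans cs s1) L.
move=> /le_trans; apply; rewrite /edges_mean.
have c0 : 0 <= (r.-1)%:R * (#|'I_n| - r)%:R * (p * s) by rewrite !mulr_ge0.
rewrite [leRHS]mulrACA ler_wpM2l ?mulr_ge0 //; apply: ler_pM => //.
  by rewrite addr_ge0 ?exprn_ge0 // !mulr_ge0.
by apply: lerD; [apply: lerXn2r; rewrite ?nnegrE | rewrite !ler_wpM2l ?mulr_ge0].
Qed.

(** Proportional to the number of ordered pairs of conflicting edges. *)
Definition degree_total G : nat :=
  (\sum_(e in G) \sum_(x in e) fresh_walks 1 e e x G)%N.

Lemma mean_degree_total p : 0 <= p <= 1 -> (r.-1)%:R * (n - r)%:R * p <= 1 ->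
  mean (law p) degree_total <= r%:R * edges_mean p.
Proof.
move=> hp c1; have /andP[p0 p1] := hp.
have w0 G : 0 <= law p G by apply: law_ge0.
have := mean_fresh_total w0 p0 (@law_rgraph p) (@mean_law_incl p) 1.
move=> /le_trans; apply; rewrite card_ord expr1 /edges_mean.
rewrite [leRHS](_ : _ = #|ksets 'I_n r|%:R * r%:R * (p * 1)); last by ring.
by rewrite ler_wpM2l // ler_wpM2l.
Qed.

Lemma mean_card p : mean (law p) (fun G => #|G|) = edges_mean p.
Proof.
rewrite (eq_mean (g := fun G => \sum_(e in ksets 'I_n r) (e \in G))%N); last first.
  by move=> G /law_rgraph; apply: card_rgraph_sum.
rewrite mean_sum /edges_mean mulr_natl -sumr_const; apply: eq_bigr => e ek.
exact: mean_law_mem.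
Qed.

Lemma mean_card_sq p : 0 <= p <= 1 ->
  mean (law p) (fun G => #|G| * #|G|)%N <= edges_mean p ^+ 2 + edges_mean p.
Proof.
move=> /andP[p0 p1].
rewrite (eq_mean (g := fun G => \sum_(e in ksets 'I_n r) \sum_(f in ksets 'I_n r)
   ([set e; f]%SET \subset G))%N); last first.
  move=> G /law_rgraph rG; rewrite card_rgraph_sum // big_distrlr /=.
  by apply: eq_bigr => e _; apply: eq_bigr => f _; rewrite subUset !sub1set mulnb.
rewrite mean_sum; under eq_bigr do rewrite mean_sum.
apply: (@le_trans _ _ (\sum_(e in ksets 'I_n r) (\sum_(f in ksets 'I_n r) p ^+ 2 + p))).
  apply: ler_sum => e ek; rewrite (bigD1 e) //= [X in _ <= X + _](bigD1 e) //= addrAC.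
  rewrite -addrA [leRHS]addrA [X in _ <= X + _]addrC lerD //; last first.
    apply: ler_sum => f /andP[fk fe]; rewrite mean_law_incl.
      by rewrite cards2 eq_sym fe.
    by rewrite subUset !sub1set ek.
  rewrite mean_law_incl; first by rewrite cards2 eqxx expr1 ler_wpDr // exprn_ge0.
  by rewrite subUset !sub1set ek.
under eq_bigr do rewrite sumr_const -[_ *+ _]mulr_natl.
rewrite sumr_const -[leLHS]mulr_natl /edges_mean; move: (_%:R) => k.
apply: eq_ler; ring.
Qed.

(** Chebyshev's inequality, the variance of the number of edges being at most
    its mean. *)
Lemma few_edges_prob p : 0 <= p <= 1 -> 0 < edges_mean p ->
  prob (law p) (fun G => #|G|%:R < 3 / 4 * edges_mean p) <= 16 / edges_mean p.
Proof.
move=> hp m0; set m := edges_mean p in m0 *.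
have w0 G : 0 <= law p G by apply: law_ge0.
have var : \sum_G law p G * (#|G|%:R - m) ^+ 2 <= m.
  have -> : \sum_G law p G * (#|G|%:R - m) ^+ 2 =
    mean (law p) (fun G => #|G| * #|G|)%N + ((- 2 * m) * mean (law p) (fun G => #|G|) +
      m ^+ 2 * \sum_G law p G).
    rewrite /mean !mulr_sumr -!big_split; apply: eq_bigr => G _ /=.
    by rewrite natrM; ring.
  rewrite mean_card sum_law; have := mean_card_sq hp; rewrite -/m; nra.
rewrite ler_pdivlMr // -(ler_pM2r m0) /prob mulr_suml mulr_suml big_mkcond.
apply: (@le_trans _ _ (16 * \sum_G law p G * (#|G|%:R - m) ^+ 2)).
  rewrite mulr_sumr; apply: ler_sum => G _; case: ifP => [h|_].
    rewrite [leRHS]mulrCA -mulrA ler_wpM2l //.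
    by have : 0 <= (#|G|%:R : R) by []; nra.
  by rewrite mulr_ge0 // mulr_ge0 // sqr_ge0.
by rewrite ler_wpM2l.
Qed.

(** Two regimes.  If the mean number of edges is at most j^2, the gap is a
    natural number of mean at most 1/j^2, hence mostly 0.  Otherwise three
    events of probability O(1/j) are excluded: a gap of at least mu/j^2, at
    least j mu conflicts, and fewer than 3 mu / 4 edges.  Outside them tau is at
    least mu / (8 j), so the gap is at most (8/j) tau. *)
Lemma gap_prob p (j : nat) : (1 < r)%N -> (0 < j)%N -> 0 <= p <= 1 ->
  (r.-1)%:R * (n - r)%:R * p <= 1 ->
  mean (law p) gap <= edges_mean p / j%:R ^+ 4 ->
  prob (law p) (fun G => ~~ (`|(matching_number r G)%:R - (cover_number r G)%:R : R| <=
     8 / j%:R * (cover_number r G)%:R)) <= (17 + r)%:R / j%:R.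
Proof.
move=> r1 j0 hp c1 gapE; have /andP[p0 p1] := hp.
set m := edges_mean p in gapE *; pose J : R := j%:R.
have J1 : 1 <= J by rewrite ler1n.
have J0 : 0 < J by rewrite ltr0n.
have w0 G : 0 <= law p G by apply: law_ge0.
have m0 : 0 <= m by apply: edges_mean_ge0.
have gapR G : law p G != 0 -> `|(matching_number r G)%:R - (cover_number r G)%:R| = (gap G)%:R :> R.
  move=> /law_rgraph rG; have le := matching_le_cover rG.
  by rewrite distrC ger0_norm ?subr_ge0 ?ler_nat // /gap natrB.
have iJ1 : J^-1 <= 1 by rewrite invf_le1.
have iJ0 : 0 < J^-1 by rewrite invr_gt0.
have [small|large] := lerP m (J ^+ 2).
  have := @mean_markov _ _ _ w0 (fun G => (0 < gap G)%N) gap 1 ltr01.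
  move=> /(_ _)/le_trans h; apply: le_trans (h _ _ _).
  - apply: prob_le => // G wG; rewrite gapR // lt0n; apply: contraNneq => ->.
    by rewrite !mulr_ge0 // ltW.
  - by move=> G; rewrite ler1n.
  rewrite divr1; apply: le_trans gapE _; rewrite -/J.
  apply: (@le_trans _ _ J^-1); last first.
    by rewrite -[leLHS]mul1r ler_wpM2r ?(ltW iJ0) // ler1n addSn.
  rewrite ler_pdivrMr ?exprn_gt0 // exprS mulKf ?gt_eqF //.
  exact: le_trans small (ler_weXn2l _ _).
have mp : 0 < m by apply: lt_trans large; rewrite exprn_gt0.
pose P1 : pred {set {set 'I_n}} := fun G => m / J ^+ 2 <= (gap G)%:R.
pose P2 : pred {set {set 'I_n}} := fun G => J * m <= (degree_total G)%:R.
pose P3 : pred {set {set 'I_n}} := fun G => #|G|%:R < 3 / 4 * m.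
have b1 : prob (law p) P1 <= J^-1.
  have a0 : 0 < m / J ^+ 2 by rewrite divr_gt0 // exprn_gt0.
  apply: le_trans (mean_markov w0 a0 (fun G h => h)) _.
  rewrite ler_pdivrMr //; apply: le_trans gapE _; rewrite -/J.
  rewrite mulrCA ler_wpM2l //.
  have -> : J ^- 4 = J^-1 ^+ 4 by rewrite exprVn.
  have -> : J ^- 2 = J^-1 ^+ 2 by rewrite exprVn.
  rewrite -exprS; apply: ler_wiXn2l => //; exact: ltW.
have b2 : prob (law p) P2 <= r%:R / J.
  have a0 : 0 < J * m by rewrite mulr_gt0.
  apply: le_trans (mean_markov w0 a0 (fun G h => h)) _.
  rewrite ler_pdivrMr //; apply: le_trans (mean_degree_total hp c1) _.
  by rewrite [leRHS]mulrA divfK // gt_eqF.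
have b3 : prob (law p) P3 <= 16 / J.
  apply: le_trans (few_edges_prob hp mp) _.
  rewrite -/m ler_wpM2l // lef_pV2 ?posrE //; apply: le_trans (ltW large).
  by rewrite expr2 -[leLHS]mul1r ler_wpM2r // ltW.
apply: (@le_trans _ _ (prob (law p) (predU P1 (predU P2 P3)))).
  apply: prob_le => // G wG; rewrite gapR // => bad /=.
  apply: contraR bad; rewrite !negb_or /P1 /P2 /P3 -!ltNge -leNgt => /and3P[h1 h2 h3].
  have rG := law_rgraph wG; have [C cC CE] := cover_number_attained rG.
  (* With threshold 2j, fewer than j mu conflicts account for at most mu / 2 of
     the edges, which leaves at least mu / 4 edges of low degree. *)
  have := cover_ge_low_degree (2 * j) r1 rG cC; rewrite -CE -/(degree_total G).
  rewrite -(ler_nat R) natrD !natrM -/J => h4.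
  have h5 : m <= 8 * J * (cover_number r G)%:R.
    rewrite -(ler_pM2l J0); nra.
  apply: le_trans (ltW h1) _; rewrite ler_pdivrMr ?exprn_gt0 //.
  by apply: le_trans h5 _; apply: eq_ler; field; rewrite gt_eqF.
apply: le_trans (probU w0 _ _) _.
apply: (@le_trans _ _ (J^-1 + (r%:R / J + 16 / J))); last first.
  by apply: eq_ler; rewrite natrD -/J; field; rewrite gt_eqF.
apply: lerD b1 _; apply: le_trans (probU w0 _ _) _; exact: lerD.
Qed.
End Law.

Lemma Hr_probE (R : realType) r n (p : R) (E : pred {set {set 'I_n}}) :
  Hr_prob r p E = prob (law r p) E.
Proof.
rewrite /Hr_prob /prob big_mkcond [RHS]big_mkcond; apply: eq_bigr => G _.
by rewrite /law; case: is_rgraph; case: (E G).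
Qed.

Lemma prob_lawC (R : realType) r n (p : R) (E : pred {set {set 'I_n}}) :
  prob (law r p) E = 1 - prob (law r p) (fun G => ~~ E G).
Proof. by rewrite -(sum_law r n p) /prob [X in _ = X - _](bigID E) /= addrK. Qed.

(** * Letting n tend to infinity *)
Section Limits.
Variables (R : realType) (r : nat) (p : nat -> R).
Hypotheses (r_gt1 : (1 < r)%N) (hp : forall n, 0 <= p n <= 1).
Hypothesis hd : forall n, (n%:R - (r%:R - 1)) * p n <= 1 / (r%:R - 1).

Lemma predr_natr : (r.-1)%:R = r%:R - 1 :> R.
Proof. by rewrite -subn1 natrB // ltnW. Qed.

Lemma codegree_le1 n : (r <= n)%N -> (r.-1)%:R * (n - r).+1%:R * p n <= 1.
Proof.
move=> rn; have r1 : 0 < r%:R - 1 :> R by rewrite subr_gt0 ltr1n.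
have := hd n; rewrite ler_pdivlMr // predr_natr -natr1 natrB //.
by apply: le_trans; apply: eq_ler; ring.
Qed.

(** The fraction lost to thinning, the long fresh walks and the stale walks are
    each given a third of 1/j^4; only the last depends on n, through
    p = O(1/n). *)
Lemma mean_gap_small j : (0 < j)%N -> exists N, forall n, (N <= n)%N ->
  mean (law r (p n)) (@gap r n) <= edges_mean r n (p n) / j%:R ^+ 4.
Proof.
move=> j0; have J0 : 0 < (j%:R : R) by rewrite ltr0n.
have J1 : 1 <= (j%:R : R) by rewrite ler1n.
pose a : R := (j%:R ^+ 4)^-1.
have a0 : 0 < a by rewrite invr_gt0 exprn_gt0.
have a1 : a <= 1 by rewrite invf_le1 ?exprn_gt0 // exprn_ege1.
pose s : R := 1 - a / 3.
have s0 : 0 <= s by rewrite /s; lra.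
have s1 : s < 1 by rewrite /s; lra.
have rR : 0 < (r%:R : R) by rewrite ltr0n ltnW.
have [L hL] : exists L, s ^+ L <= a / 3 / r%:R.
  have e0 : 0 < a / 3 / r%:R by rewrite !divr_gt0.
  have /cvgrPdist_le/(_ _ e0)[L _ hL] : (s ^+ n @[n --> \oo] --> 0)%classic.
    by apply: cvg_expr; rewrite ger0_norm.
  exists L; have := hL L (leqnn L).
  by rewrite sub0r normrN ger0_norm // exprn_ge0.
exists (r + 3 * r * L * (r + L) * j ^ 4)%N => n Nn.
have rn : (r <= n)%N := leq_trans (leq_addr _ _) Nn.
have hn := hp n; have /andP[p0 p1] := hn.
have c1 := codegree_le1 rn.
apply: le_trans (mean_gap (s := s) L (ltnW r_gt1) hn _ _) _.
- by rewrite s0 ltW.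
- by apply: le_trans c1; rewrite ler_wpM2r // ler_wpM2l // ler_nat.
rewrite ler_wpM2l ?edges_mean_ge0 // -/a.
have h1 : r%:R * s ^+ L <= a / 3 by rewrite mulrC -ler_pdivlMr.
have h2 : r%:R * (L%:R * ((r.-1)%:R * (r + L)%:R * p n)) <= a / 3.
  have big : (3 * r * L * (r + L) * j ^ 4 <= (n - r).+1)%N.
    by rewrite leqW // leq_subRL.
  have bigR : 3 * r%:R * L%:R * (r + L)%:R * j%:R ^+ 4 <= (n - r).+1%:R :> R.
    by rewrite -natrX -!natrM ler_nat.
  have aJ : a * j%:R ^+ 4 = 1 by rewrite mulVf // gt_eqF // exprn_gt0.
  have pr : 0 <= (r.-1)%:R * p n by rewrite mulr_ge0.
  have le1 : (r.-1)%:R * p n * (3 * r%:R * L%:R * (r + L)%:R * j%:R ^+ 4) <= 1.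
    by apply: le_trans (ler_wpM2l pr bigR) _; rewrite mulrAC.
  have := ler_wpM2l (ltW a0) le1; rewrite mulr1.
  have -> : a * ((r.-1)%:R * p n * (3 * r%:R * L%:R * (r + L)%:R * j%:R ^+ 4)) =
    (a * j%:R ^+ 4) * ((r.-1)%:R * p n * (3 * r%:R * L%:R * (r + L)%:R)).
    by move: (r.-1%:R) (_ ^+ 4) ((r + L)%:R) => u v w; ring.
  rewrite aJ mul1r; move: (r.-1%:R) ((r + L)%:R) => u v.
  by move: (r%:R) (L%:R) => u' v'; lra.
by rewrite /s mulrDr; lra.
Qed.

Lemma cvg_of_rate (k : nat -> nat) (f : nat -> R) (l c : R) : 0 <= c ->
  (forall J, exists N, forall n, (N <= n)%N -> (J <= k n)%N) ->
  (forall n, (0 < k n)%N -> `|l - f n| <= c / (k n)%:R) ->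
  (f n @[n --> \oo] --> l)%classic.
Proof.
move=> c0 kinf fk; apply/cvgrPdist_le => e e0.
have [J hJ] : exists J : nat, c / e < J%:R.
  by exists (Num.bound (c / e)); apply: archi_boundP; rewrite divr_ge0 // ltW.
have [N hN] := kinf J.+1; exists N => // n /= /hN kn.
have k0 : (0 < k n)%N by apply: leq_trans kn.
apply: le_trans (fk n k0) _; rewrite ler_pdivrMr ?ltr0n // mulrC -ler_pdivrMr //.
by apply: ltW; apply: lt_le_trans hJ _; rewrite ler_nat ltnW.
Qed.
End Limits.

(** Take for k n the largest j <= n such that P j n holds; the value 0 stands
    for the absence of such a j. *)
Lemma diagonal_index (P : nat -> nat -> Prop) :
  (forall j, (0 < j)%N -> exists N, forall n, (N <= n)%N -> P j n) ->
  exists2 k : nat -> nat,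
    forall J, exists N, forall n, (N <= n)%N -> (J <= k n)%N &
    forall n, (0 < k n)%N -> P (k n) n.
Proof.
move=> evP; pose k n := \max_(j < n.+1 | `[< P j n >]) j; exists k.
- case=> [|J]; first by exists 0%N.
  have [N hN] := evP J.+1 isT; exists (maxn N J.+1) => n.
  rewrite geq_max => /andP[Nn Jn].
  apply: (bigop.bigmax_sup (Ordinal (Jn : (J.+1 < n.+1)%N))) => //.
  exact/asboolP/hN.
move=> n; rewrite /k; elim/big_ind: _ => // [x y hx hy|j /asboolP //].
by rewrite /maxn; case: ifP.
Qed.

Theorem theorem1p9 (R : realType) (r : nat) (p d : nat -> R)
  (hr : (3 <= r)%N)
  (hp : forall n : nat, 0 <= p n <= 1)
  (hd_def : forall n : nat, d n = (n%:R - (r%:R - 1)) * p n)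
  (hd : forall n : nat, d n <= 1 / (r%:R - 1)) :
  whp_sim r p (fun n G => matching_number r G) (fun n G => cover_number r G).
Proof.
have r1 : (1 < r)%N := ltnW hr.
have hd' n : (n%:R - (r%:R - 1)) * p n <= 1 / (r%:R - 1) by rewrite -hd_def.
pose near_equal j n (G : {set {set 'I_n}}) : bool :=
  `|(matching_number r G)%:R - (cover_number r G)%:R| <=
    8 / j%:R * (cover_number r G)%:R :> R.
have evP j : (0 < j)%N -> exists N, forall n, (N <= n)%N ->
    prob (law r (p n)) (fun G => ~~ near_equal j n G) <= (17 + r)%:R / j%:R.
  move=> j0; have [N hN] := mean_gap_small r1 hp hd' j0.
  exists (maxn N r) => n; rewrite geq_max => /andP[Nn rn].
  apply: gap_prob => //; last exact: hN.
  have /andP[p0 _] := hp n; apply: le_trans (codegree_le1 r1 hd' rn).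
  by rewrite ler_wpM2r // ler_wpM2l // ler_nat.
have [k kinf kP] := diagonal_index evP.
exists (fun n => 8 / (k n)%:R).
  apply: (cvg_of_rate (c := 8) _ kinf) => // n k0.
  by rewrite sub0r normrN ger0_norm // divr_ge0.
apply: (cvg_of_rate (c := (17 + r)%:R) _ kinf) => // n k0.
rewrite Hr_probE prob_lawC opprB addrC subrK ger0_norm; first exact: kP.
by apply: sumr_ge0 => G _; apply: law_ge0.
Qed.
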